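(* Let $k\ge d$. The following identity holds: $$\widehat{\boldsymbol V}_h=\left\{\boldsymbol v_h=(\boldsymbol v_h^{\rm ct},-\mathcal R\boldsymbol v_h^{\rm ct}):\ \boldsymbol v_h^{\rm ct}\in\boldsymbol V_h^{\rm ct}\right\},$$ where $$\widehat{\boldsymbol V}_h:=\left\{\boldsymbol v_h=(\boldsymbol v_h^{\rm ct},\boldsymbol v_h^{\rm R})\in\boldsymbol V_h:\ \int_\Omega\mathrm{div}(\boldsymbol v_h^{\rm ct}+\boldsymbol v_h^{\rm R})\lambda_h\,d\boldsymbol x=0\quad\forall\lambda_h\in\widehat Q_h^\perp\right\}.$$
   Context: Let $d\in\{2,3\}$, $\Omega\subset\mathbb R^d$ a bounded domain with polyhedral Lipschitz boundary, $\boldsymbol V:=H^1_0(\Omega)^d$, $Q:=L^2_0(\Omega)$ (zero mean), $(\cdot,\cdot)$ the $L^2(\Omega)$ inner product ($(\cdot,\cdot)_T$ over $T$). $\mathcal T$ is a regular (conforming) simplicial triangulation of $\Omega$ from a shape-regular family. $P_k(T)$: polynomials of degree $\le k$ on $T$ (bold = vector-valued). $P_k(\mathcal T)=\{q\in H^1(\Omega):q|_T\in P_k(T)\ \forall T\in\mathcal T\}$, $P_k^{\rm disc}(\mathcal T)=\{q\in L^2(\Omega):q|_T\in P_k(T)\ \forall T\}$, $\widetilde P_k^{\rm disc}(\mathcal T)=\{q\in P_k^{\rm disc}(\mathcal T):(q,1)_T=0\ \forall T\}$. $\boldsymbol{RT}_m(T)=\{\boldsymbol p+q\boldsymbol x:\boldsymbol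 p\in\boldsymbol P_m(T),q\in P_m(T)\}$, $\boldsymbol{RT}_m^{\rm int}(\mathcal T)=\{\boldsymbol v\in\boldsymbol H(\mathrm{div},\Omega):\boldsymbol v|_T\in\boldsymbol{RT}_m(T),\ \boldsymbol v\cdot\boldsymbol n_T|_{\partial T}=0\ \forall T\}$. $\widetilde{\boldsymbol{RT}}{}_m^{\rm int}(\mathcal T)$ is a fixed complement in $\boldsymbol{RT}_m^{\rm int}(\mathcal T)$ of its subspace of divergence-free functions (its local spaces being images under the Piola transformation of one common reference space). $\boldsymbol V_h^{\rm ct}:=\boldsymbol P_k(\mathcal T)\cap\boldsymbol V$, $Q_h:=P_{k-1}^{\rm disc}(\mathcal T)\cap Q$, $\widehat Q_h=\{q\in Q:q|_T\in\widehat Q_h(T)\ \forall T\}$ with subspaces $P_0(T)\subseteq\widehat Q_h(T)\subseteq P_{k-1}(T)$ such that $(\boldsymbol V_h^{\rm ct},\widehat Q_h)$ is inf-sup stable; $\widehat Q_h^\perp$ is the $L^2$-orthogonal complement of $\widehat Q_h$ in $Q_h$ (so $\widehat Q_h^\perp\subseteq\widetilde P_{k-1}^{\rm disc}(\mathcal T)$). $\boldsymbol V_h^{\rm R}\subseteq\widetilde{\boldsymbol{RT}}{}_{k-1}^{\rm int}(\mathcal T)$ is a subspace such that $\mathrm{div}:\boldsymbol V_h^{\rm R}\to\widehat Q_h^\perp$ is bijective. $\boldsymbol V_h:=\boldsymbol V_h^{\rm ct}\times\boldsymbol V_h^{\rm R}$. $\mathcal R:\boldsymbol V\to\boldsymbol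 V_h^{\rm R}$ is defined by: $\mathcal R\boldsymbol v$ is the unique element of $\boldsymbol V_h^{\rm R}$ with $\mathrm{div}(\mathcal R\boldsymbol v)=\pi_{\widehat Q_h^\perp}\mathrm{div}(\boldsymbol v)$, where $\pi_{\widehat Q_h^\perp}$ is the $L^2$ projection onto $\widehat Q_h^\perp$. *)

(* Defs.v *)
From HB Require Import structures.
From mathcomp Require Import all_boot all_order all_algebra.
From mathcomp Require Import all_classical all_reals all_analysis.
From mathcomp Require Import measurable_realfun lra.
From mathcomp Require Import (canonicals, coercions) mpoly.

Set Implicit Arguments.
Unset Strict Implicit.
Unset Printing Implicit Defensive.
Import Order.TTheory GRing.Theory Num.Theory.
Import numFieldNormedType.Exports.
Local Open Scope classical_set_scope.
Local Open Scope ring_scope.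

Definition borel_row_display : measure_display.
Proof. exact: default_measure_display. Qed.

Section borel_row.
Context (R : realType) (n : nat).

Let borel : set (set 'rV[R]_n) := <<s open >>.

Let borel0 : borel set0. Proof. exact: sigma_algebra0. Qed.

Let borelC A : borel A -> borel (~` A).
Proof. exact: sigma_algebraC. Qed.

Let borel_bigcup (F : (set 'rV[R]_n)^nat) :
  (forall i, borel (F i)) -> borel (\bigcup_i F i).
Proof. exact: sigma_algebra_bigcup. Qed.

HB.instance Definition _ := @isMeasurable.Build borel_row_display 'rV[R]_n
  borel borel0 borelC borel_bigcup.

Lemma open_measurable_row (A : set 'rV[R]_n) : open A -> measurable A.
Proof. exact: sub_sigma_algebra. Qed.

End borel_row.

Section cons_row.
Context {R : realType} (n : nat).

Definition cons_row (x : measurableTypeR R * 'rV[R]_n) : 'rV[R]_(1 + n) :=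
  row_mx (x.1 : R)%:M x.2.

Let rbox (q : rat * rat * 'rV[rat]_n) : set (measurableTypeR R * 'rV[R]_n) :=
  ball (ratr q.1.1 : R) (ratr q.1.2) `*` ball (map_mx ratr q.2 : 'rV[R]_n) (ratr q.1.2).

Lemma measurable_cons_row : measurable_fun setT cons_row.
Proof.
apply: (@measurability _ _ _ _ _ _ (@open 'rV[R]_(1 + n))) => //.
move=> _ [U oU <-]; rewrite setTI.
rewrite (_ : _ @^-1` _ = \bigcup_(q in [set q | rbox q `<=` cons_row @^-1` U]) rbox q).
  rewrite bigcup_mkcond; apply: countable_bigcupT_measurable => // q.
  case: ifP => // _; apply: measurableX; last first.
    by apply: open_measurable_row; exact: ball_open.
  exact: measurable_ball.
apply/seteqP; split=> [[x y] Uxy|xy [q]]; last by move=> + qxy; exact.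
have /nbhs_ballP[e /= e0 eU] : nbhs (cons_row (x, y)) U.
  by apply: open_nbhs_nbhs; split.
have [r /andP[r0 re]] : exists r : rat, (0 : R) < ratr r < e / 2.
  by have [r] := rat_in_itvoo (divr_gt0 e0 (ltr0n _ 2)); rewrite in_itv; exists r.
have dr (z : R) : exists q : rat, ball (ratr q : R) (ratr r) z.
  have /rat_in_itvoo[q] : z - ratr r < z + ratr r by lra.
  rewrite in_itv /= => zq; exists q.
  by apply: ball_sym; rewrite /ball/= distrC ltr_distl.
have [q qx] := dr x; have /choice[p py] := dr.
exists (q, r, map_mx p y); last first.
  by split => //=; split => // i j; rewrite !mxE.
move=> [x' y'] [/= qx' [_ qy']]; apply: eU => /=.
have h (a b c : R) : ball a (ratr r) b -> ball a (ratr r) c -> ball b e c.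
  move=> /ball_sym ab ac; apply: (@le_ball _ _ _ (ratr r + ratr r)); last exact: ball_triangle ab ac.
  by rewrite ltW//; lra.
split=> // i j; rewrite /cons_row !mxE; case: splitP => k _.
  by rewrite !mxE (ord1 k) (ord1 i) eqxx !mulr1n; exact: h qx qx'.
by apply: (h (ratr (p (y i k)))); [exact: py|have := qy' i k; rewrite !mxE].
Qed.

Variable m : {sigma_finite_measure set 'rV[R]_n -> \bar R}.

Definition leb_cons : set 'rV[R]_(1 + n) -> \bar R :=
  pushforward (@lebesgue_measure R \x m)%E cons_row.

Let leb_cons0 : leb_cons set0 = 0%E.
Proof. by rewrite /leb_cons /pushforward preimage_set0 measure0. Qed.

Let leb_cons_ge0 A : (0 <= leb_cons A)%E.
Proof. by rewrite /leb_cons /pushforward; exact: measure_ge0. Qed.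

Let leb_cons_sigma_additive : semi_sigma_additive leb_cons.
Proof.
move=> F mF tF mUF; rewrite /leb_cons /pushforward preimage_bigcup.
apply: measure_semi_sigma_additive.
- by move=> i; rewrite -[X in measurable X]setTI; exact: measurable_cons_row.
- apply/trivIsetP => /= i j _ _ ij; rewrite -preimage_setI.
  by move/trivIsetP : tF => /(_ _ _ _ _ ij) ->//; rewrite preimage_set0.
- by rewrite -preimage_bigcup -[X in measurable X]setTI; exact: measurable_cons_row.
Qed.

HB.instance Definition _ := isMeasure.Build _ _ _ leb_cons
  leb_cons0 leb_cons_ge0 leb_cons_sigma_additive.

Let measurable_head :
  measurable_fun setT (fun x : 'rV[R]_(1 + n) => x 0 (lshift n 0)).
Proof.
apply: (measurability _ (RGenOpens.measurableE R)).
move=> _ [_ [a [b ->]] <-]; rewrite setTI; apply: open_measurable_row.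
have oU : open `]a, b[%classic by exact: interval_open.
exact: (proj1 (continuousP _) (@coord_continuous R 1 (1 + n) 0 (lshift n 0)) _ oU).
Qed.

Let measurable_tail : measurable_fun setT (fun x : 'rV[R]_(1 + n) => rsubmx x).
Proof.
apply: (@measurability _ _ _ _ _ _ (@open 'rV[R]_n)) => //.
move=> _ [U oU <-]; rewrite setTI; apply: open_measurable_row.
rewrite openE => x /= Ux.
have /nbhs_ballP[e /= e0 eU] : nbhs (rsubmx x) U by apply: open_nbhs_nbhs; split.
apply/nbhs_ballP; exists e => //= y [_ xy]; apply: eU; split => // i j.
by rewrite !mxE.
Qed.

Let leb_cons_sigma_finite : sigma_finite setT leb_cons.
Proof.
have [F FT Foo] := sigma_finiteT (@lebesgue_measure R).
have [G GT Goo] := sigma_finiteT m.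
exists (fun k => [set x : 'rV[R]_(1 + n) |
    F (odflt (0%N, 0%N) (unpickle k)).1 (x 0 (lshift n 0)) /\
    G (odflt (0%N, 0%N) (unpickle k)).2 (rsubmx x)]).
  apply/seteqP; split=> // x _.
  have [i _ Fi] : (\bigcup_i F i) (x 0 (lshift n 0)) by rewrite -FT.
  have [j _ Gj] : (\bigcup_i G i) (rsubmx x) by rewrite -GT.
  by exists (pickle (i, j)) => //=; rewrite pickleK.
move=> k; set i := _.1; set j := _.2.
have [mF Foo_] := Foo i; have [mG Goo_] := Goo j.
split.
  rewrite (_ : [set _ | _] = (setT `&` (fun x : 'rV[R]_(1 + n) => x 0 (lshift n 0)) @^-1` F i) `&`
      (setT `&` (fun x : 'rV[R]_(1 + n) => rsubmx x) @^-1` G j)); last by rewrite !setTI.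
  by apply: measurableI; [exact: measurable_head|exact: measurable_tail].
rewrite /leb_cons /pushforward (_ : _ @^-1` _ = F i `*` G j).
  by rewrite product_measure1E// lte_mul_pinfty// ge0_fin_numE.
apply/seteqP; split=> -[x y] /=; rewrite /cons_row /= row_mxKr row_mxEl !mxE.
  by rewrite eqxx mulr1n.
by rewrite eqxx mulr1n.
Qed.

HB.instance Definition _ := Measure_isSigmaFinite.Build _ _ _ leb_cons
  leb_cons_sigma_finite.

End cons_row.

(* Lebesgue measure on the Borel sets of R^n, as an iterated product. *)
Fixpoint leb {R : realType} (n : nat) : {sigma_finite_measure set 'rV[R]_n -> \bar R} :=
  if n is n'.+1 then leb_cons (leb n') else \d_(0 : 'rV[R]_0).

Section euclidean.
Context {R : realType} {d : nat}.
Local Notation Rd := 'rV[R]_d.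

Definition dot (x y : Rd) : R := \sum_i x 0 i * y 0 i.

Definition enorm (x : Rd) : R := Num.sqrt (dot x x).

Definition diam (A : set Rd) : R := sup [set enorm (x - y) | x in A & y in A].

Definition inradius (A : set Rd) : R :=
  sup [set r | 0 <= r /\ exists x, forall y, enorm (y - x) <= r -> A y].

(* The face of the simplex (or convex polytope) with vertices the rows of A
   spanned by the vertices whose index satisfies J. *)
Definition face {m : nat} (A : 'M[R]_(m, d)) (J : {pred 'I_m}) : set Rd :=
  [set x | exists l : 'rV[R]_m, [/\ forall i, 0 <= l 0 i, \sum_i l 0 i = 1,
     forall i, i \notin J -> l 0 i = 0 & x = l *m A]].

Definition conv {m : nat} (A : 'M[R]_(m, d)) : set Rd := face A predT.

Definition boundary (A : set Rd) : set Rd := closure A `\` interior A.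

Definition lipschitz_map (g : Rd -> R) :=
  exists L : R, forall x y, `|g x - g y| <= L * enorm (x - y).

(* Near each boundary point, Om is the strict epigraph, in the direction of a
   unit vector e, of a Lipschitz function g; only the values of g on the
   hyperplane orthogonal to e matter. *)
Definition lipschitz_boundary (Om : set Rd) :=
  forall x, boundary Om x -> exists (e : Rd) (g : Rd -> R) (r : R),
    [/\ dot e e = 1, lipschitz_map g, 0 < r &
      forall z, enorm (z - x) < r ->
        (Om z <-> g (z - dot z e *: e) < dot z e)].

(* s lists the vertices of simplicial pieces of dimension (at most) d - 1. *)
Definition polyhedral_boundary (Om : set Rd) :=
  exists s : seq 'M[R]_d, boundary Om = \bigcup_(F in [set` s]) conv F.

Definition bounded_polyhedral_lipschitz_domain (Om : set Rd) :=
  [/\ Om !=set0, open Om, connected Om & bounded_set Om] /\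
  polyhedral_boundary Om /\ lipschitz_boundary Om.

End euclidean.

(* Functions are total functions on R^d. Elements of L^2(Om) are classes of
   such functions for almost everywhere equality on Om. *)
Section function_spaces.
Context {R : realType} {d : nat}.
Local Notation Rd := 'rV[R]_d.
Implicit Types (Om : set Rd) (u g q : Rd -> R) (v : Rd -> Rd).

Definition aeq {U : Type} (A : set Rd) (f g : Rd -> U) := ae_eq (leb d) A f g.

Definition L2 Om u :=
  measurable_fun Om u /\ (leb d).-integrable Om (fun x => (u x ^+ 2)%:E).

Definition ip Om u g : R := \int[leb d]_(x in Om) (u x * g x).

Definition l2norm Om u : R := Num.sqrt (ip Om u u).

Definition partial (i : 'I_d) u : Rd -> R := fun x => 'D_(delta_mx 0 i) u x.

Fixpoint Cn (n : nat) u : Prop :=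
  continuous u /\
  if n is m.+1 then
    forall i, (forall x, derivable u x (delta_mx 0 i)) /\ Cn m (partial i u)
  else True.

Definition test_fun Om u :=
  (forall n, Cn n u) /\
  exists K : set Rd, [/\ compact K, K `<=` Om & forall x, ~ K x -> u x = 0].

Definition is_weak_partial Om (i : 'I_d) u g :=
  L2 Om g /\
  forall phi, test_fun Om phi -> ip Om u (partial i phi) = - ip Om g phi.

Definition weak_partial Om (i : 'I_d) u : Rd -> R :=
  get [set g | is_weak_partial Om i u g].

Definition H1 Om u := L2 Om u /\ forall i, exists g, is_weak_partial Om i u g.

(* H^1_0 is the closure of the test functions in H^1. *)
Definition H10 Om u :=
  H1 Om u /\
  forall e : R, 0 < e -> exists2 phi, test_fun Om phi &
    l2norm Om (u \- phi) ^+ 2 +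
    \sum_i l2norm Om (weak_partial Om i u \- partial i phi) ^+ 2 < e ^+ 2.

Definition comp v (i : 'I_d) : Rd -> R := fun x => v x 0 i.

Definition is_weak_div Om v g :=
  L2 Om g /\
  forall phi, test_fun Om phi ->
    \sum_i ip Om (comp v i) (partial i phi) = - ip Om g phi.

Definition Hdiv Om v :=
  (forall i, L2 Om (comp v i)) /\ exists g, is_weak_div Om v g.

Definition div Om v : Rd -> R := get [set g | is_weak_div Om v g].

Definition H10v Om v := forall i, H10 Om (comp v i).

(* The norm of H^1_0, i.e. the L^2 norm of the gradient. *)
Definition h1norm Om v : R :=
  Num.sqrt (\sum_i \sum_j l2norm Om (weak_partial Om i (comp v j)) ^+ 2).

Definition L20 Om q := L2 Om q /\ \int[leb d]_(x in Om) q x = 0.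

Definition l2proj Om (S : set (Rd -> R)) g : Rd -> R :=
  get [set p | S p /\ forall q, S q -> ip Om (g \- p) q = 0].

End function_spaces.

Definition is_subspace {R : realType} {V : lmodType R} (S : set V) :=
  S 0 /\ forall (a : R) u v, S u -> S v -> S (a *: u + v).

(* W is a complement of N in S, all elements being read modulo equality a.e. *)
Definition is_complement {R : realType} {d : nat} (Om : set 'rV[R]_d)
    (S N W : set ('rV[R]_d -> 'rV[R]_d)) :=
  [/\ is_subspace W, W `<=` S,
      forall w, W w -> N w -> aeq Om w (cst 0) &
      forall v, S v -> exists w n, [/\ W w, N n & aeq Om v (w \+ n)]].

(* A and B are the same set of pairs of classes modulo equality a.e. *)
Definition same_classes {R : realType} {d : nat} (Om : set 'rV[R]_d)
    (A B : set (('rV[R]_d -> 'rV[R]_d) * ('rV[R]_d -> 'rV[R]_d))) :=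
  let equiv v w := aeq Om v.1 w.1 /\ aeq Om v.2 w.2 in
  (forall v, A v -> exists2 w, B w & equiv v w) /\
  (forall w, B w -> exists2 v, A v & equiv v w).

Section meshes.
Context {R : realType} {d : nat}.
Local Notation Rd := 'rV[R]_d.

(* A simplex is given by its ordered vertices, the rows of the matrix. *)
Definition simplex := 'M[R]_(d.+1, d).
Definition mesh := seq simplex.

(* The affine map from the reference simplex with vertices 0, e_1, ..., e_d
   onto conv T is xh |-> row ord0 T + xh *m jac T, in row convention. *)
Definition jac (T : simplex) : 'M[R]_d :=
  \matrix_(i, j) (T (lift ord0 i) j - T ord0 j).

Definition shared (T T' : simplex) : {pred 'I_d.+1} :=
  [pred i | [exists j, row i T == row j T']].

Definition conforming_triangulation (Om : set Rd) (Th : mesh) :=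
  [/\ forall T, T \in Th -> jac T \in unitmx,
      closure Om = \bigcup_(T in [set` Th]) conv T &
      forall T T', T \in Th -> T' \in Th -> T != T' ->
        ~ (forall i, i \in shared T T') /\
        conv T `&` conv T' = face T (shared T T')].

Definition shape_regular {I : Type} (Th : I -> mesh) :=
  exists sigma : R, forall i T, T \in Th i ->
    diam (conv T) <= sigma * (2 * inradius (conv T)).

Definition facet (T : simplex) (j : 'I_d.+1) : set Rd := face T (predC1 j).

Definition outer_normal (T : simplex) (j : 'I_d.+1) (n : Rd) :=
  [/\ dot n n = 1,
      forall i i', i != j -> i' != j -> dot n (row i T - row i' T) = 0 &
      forall i, i != j -> dot n (row j T - row i T) < 0].

Definition piola (T : simplex) (w : Rd -> Rd) : Rd -> Rd := fun x =>
  (\det (jac T))^-1 *: (w ((x - row ord0 T) *m invmx (jac T)) *m jac T).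

End meshes.
Arguments simplex : clear implicits.
Arguments mesh : clear implicits.

Section finite_elements.
Context {R : realType} {d : nat}.
Local Notation Rd := 'rV[R]_d.
Local Notation poly_d := (mpoly.mpoly d R).

Definition peval (p : poly_d) : Rd -> R :=
  fun x => mpoly.meval (fun i => x 0 i) p.

(* msize is one plus the total degree. *)
Definition Pk (k : nat) : set poly_d := [set p | (mpoly.msize p <= k.+1)%N].

Definition RT_fun (p : 'I_d -> poly_d) (q : poly_d) : Rd -> Rd :=
  fun x => \row_i (peval (p i) x + peval q x * x 0 i).

Section on_a_mesh.
Variables (Om : set Rd) (Th : mesh R d).

Definition piecewise (S : simplex R d -> set poly_d) (q : Rd -> R) :=
  forall T, T \in Th -> exists2 p, S T p & aeq (conv T) q (peval p).

Definition Pcont (k : nat) : set (Rd -> R) :=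
  [set q | H1 Om q /\ piecewise (fun=> Pk k) q].

Definition Pdisc (k : nat) : set (Rd -> R) :=
  [set q | L2 Om q /\ piecewise (fun=> Pk k) q].

Definition RTint (m : nat) : set (Rd -> Rd) :=
  [set v | Hdiv Om v /\ forall T, T \in Th ->
    exists (p : 'I_d -> poly_d) (q : poly_d),
      [/\ forall i, Pk m (p i), Pk m q, aeq (conv T) v (RT_fun p q) &
          forall j n, outer_normal T j n ->
            forall x, facet T j x -> dot (RT_fun p q x) n = 0]].

Definition div_free : set (Rd -> Rd) := [set v | aeq Om (div Om v) (cst 0)].

(* The fields whose restriction to each simplex T is the Piola image of an
   element of the reference space What. *)
Definition RTtilde (What : set (Rd -> Rd)) : set (Rd -> Rd) :=
  [set v | (forall i, L2 Om (comp v i)) /\ forall T, T \in Th ->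
    exists2 w, What w & aeq (conv T) v (piola T w)].

Variable k : nat.

Definition Vct : set (Rd -> Rd) :=
  [set v | (forall i, Pcont k (comp v i)) /\ H10v Om v].

Definition Qh : set (Rd -> R) := [set q | Pdisc k.-1 q /\ L20 Om q].

Variable Qloc : simplex R d -> set poly_d.

Definition Qhat : set (Rd -> R) := [set q | L20 Om q /\ piecewise Qloc q].

Definition Qperp : set (Rd -> R) :=
  [set q | Qh q /\ forall p, Qhat p -> ip Om q p = 0].

Definition inf_sup_ge (beta : R) :=
  forall q, Qhat q -> l2norm Om q != 0 ->
    (beta%:E <= ereal_sup
       [set (ip Om (div Om v) q / (h1norm Om v * l2norm Om q))%:E
         | v in [set v | Vct v /\ h1norm Om v != 0%R]])%E.

Variable VR : set (Rd -> Rd).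

Definition div_bijective :=
  [/\ forall w, VR w -> exists2 p, Qperp p & aeq Om (div Om w) p,
      forall w w', VR w -> VR w' -> aeq Om (div Om w) (div Om w') ->
        aeq Om w w' &
      forall p, Qperp p -> exists2 w, VR w & aeq Om (div Om w) p].

Definition calR (v : Rd -> Rd) : Rd -> Rd :=
  get [set w | VR w /\ aeq Om (div Om w) (l2proj Om Qperp (div Om v))].

Definition Vh : set ((Rd -> Rd) * (Rd -> Rd)) := Vct `*` VR.

Definition Vhat : set ((Rd -> Rd) * (Rd -> Rd)) :=
  [set v | Vh v /\ forall lam, Qperp lam ->
    \int[leb d]_(x in Om) (div Om (v.1 \+ v.2) x * lam x) = 0].

End on_a_mesh.

Definition inf_sup_stable {I : Type} (Om : set Rd) (Th : I -> mesh R d)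
    (k : nat) (Qloc : I -> simplex R d -> set poly_d) :=
  exists2 beta : R, 0 < beta &
    forall i, inf_sup_ge Om (Th i) k (Qloc i) beta.

End finite_elements.

(* Main.v *)
Require Import Defs.
From HB Require Import structures.
From mathcomp Require Import all_boot all_order all_algebra.
From mathcomp Require Import all_classical all_reals all_analysis.
From mathcomp Require Import measurable_realfun ring lra.
From mathcomp Require Import (canonicals, coercions) mpoly.

Set Implicit Arguments.
Unset Strict Implicit.
Unset Printing Implicit Defensive.
Import Order.TTheory GRing.Theory Num.Theory.
Import numFieldNormedType.Exports.
Local Open Scope classical_set_scope.
Local Open Scope ring_scope.

(** The pair (v, w) lies in the constrained space exactly when div (v + w) is
    orthogonal to the orthogonal complement Q of the reduced pressure space.
    Let p be the L2 projection of div v on Q, so that div (calR v) = p. Since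
    div w belongs to Q, orthogonality of div v + div w to Q means that
    p + div w is both in Q and orthogonal to Q, that is div w = - p
    = div (- calR v), and injectivity of div on the enrichment space gives
    w = - calR v. Conversely div v - p is orthogonal to Q by definition of p.

    Two facts carry this argument once functions are read modulo equality
    almost everywhere.

    First, weak divergences must be unique, for otherwise the chosen
    divergence of v + w would be unrelated to those of v and w. This is
    [is_weak_div_unique], a consequence of [ae_zero_of_test_fun]: an integrable
    function orthogonal to all test functions vanishes almost everywhere.
    Test functions are built as products of one-variable bumps made from
    exp(-1/x), and their pointwise limits are the indicators of boxes; boxes
    are stable under intersection and generate the Borel sets.

    Second, the projection on Q must exist. [projection_exists] obtains it for
    any finite-dimensional space of square-integrable functions from a maximal
    orthonormal family, and [Qperp_l2proj] applies it to piecewise polynomials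
    of bounded degree. *)

(** * Smooth functions of one real variable *)

Section smooth1.
Context {R : realType}.
Implicit Types f g : R -> R.

Fixpoint smooth_upto (n : nat) f : Prop :=
  if n is m.+1 then (forall x, derivable f x 1) /\ smooth_upto m (derive1 f)
  else True.

Definition smooth f := forall n, smooth_upto n f.

Lemma smooth_derivable f : smooth f -> forall x, derivable f x 1.
Proof. by move=> /(_ 1%N)[]. Qed.

Lemma smooth_derive1 f : smooth f -> smooth (derive1 f).
Proof. by move=> fs n; have [] := fs n.+1. Qed.

Lemma smooth_continuous f : smooth f -> continuous f.
Proof.
by move=> /smooth_derivable df x; apply/differentiable_continuous/derivable1_diffP.
Qed.

Lemma derive1_eq f g : (forall x : R, is_derive x (1:R) f (g x)) ->
  derive1 f = g.
Proof. by move=> fg; apply/funext => x; rewrite derive1E derive_val. Qed.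

Lemma smooth_upto_le n f : smooth_upto n.+1 f -> smooth_upto n f.
Proof. by elim: n f => //= n IH f [df /IH]; split. Qed.

Lemma smooth_uptoD n f g :
  smooth_upto n f -> smooth_upto n g -> smooth_upto n (f \+ g).
Proof.
elim: n f g => //= n IH f g [df sf] [dg sg]; split.
  by move=> x; apply: derivableD.
have -> : derive1 (f \+ g) = derive1 f \+ derive1 g; last exact: IH.
by apply/funext => x; rewrite derive1E deriveD /= ?derive1E.
Qed.

Lemma smooth_uptoM n f g :
  smooth_upto n f -> smooth_upto n g -> smooth_upto n (f \* g).
Proof.
elim: n f g => //= n IH f g [df sf] [dg sg]; split.
  by move=> x; apply: derivableM.
have -> : derive1 (f \* g) = (f \* derive1 g) \+ (g \* derive1 f); last first.
  by apply: smooth_uptoD; apply: IH => //; exact: smooth_upto_le.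
by apply/funext => x; rewrite derive1E deriveM/= ?derive1E.
Qed.

(** Affine changes of variable let one function of a half-line yield bumps on
    arbitrary intervals. *)
Lemma smooth_upto_affine n f (a b : R) :
  smooth_upto n f -> smooth_upto n (fun x => f (a * x + b)).
Proof.
have da (x : R) : is_derive x (1:R) (fun x => a * x + b) a.
  by apply: is_derive_eq; rewrite addr0 /GRing.scale/= mulr1.
have smooth_upto_cst m (c : R) : smooth_upto m (cst c).
  elim: m c => //= m IH c; split; first by move=> x; exact: derivable_cst.
  by rewrite (@derive1_eq (cst c) (cst 0))// => x; exact: is_derive_cst.
elim: n f => //= n IH f [df sf].
have dfa (x : R) : is_derive x (1:R) (fun x => f (a * x + b))
    (derive1 f (a * x + b) * a).
  rewrite derive1E.
  apply: (@is_derive1_comp _ f (fun x => a * x + b)).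
  by apply: DeriveDef.
split; first by move=> x; case: (dfa x).
rewrite (derive1_eq dfa).
exact: (smooth_uptoM (IH _ sf) (smooth_upto_cst n a)).
Qed.

End smooth1.

Section flat.
Context {R : realType}.
Implicit Types P : {poly R}.

(** The functions P(1/x) exp(-1/x) on the positive half-line, extended by zero:
    unlike exp(-1/x) alone, the family over all polynomials P is stable under
    differentiation. *)
Definition flat P (x : R) : R :=
  if 0 < x then P.[x^-1] * expR (- x^-1) else 0.

Let flat_le0 P (x : R) : x <= 0 -> flat P x = 0.
Proof. by rewrite /flat leNgt => /negbTE ->. Qed.

(** With y = 1/x, the series of exp gives y^(i+1) / (i+1)! <= exp y, so that
    each monomial satisfies y^i exp(-y) <= (i+1)! x. *)
Lemma flat_linear_bound P :
  exists2 C : R, 0 <= C & forall x, `|flat P x| <= C * `|x|.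
Proof.
exists (\sum_(i < size P) `|P`_i| * (i.+1)`!%:R).
  by apply: sumr_ge0 => i _; rewrite mulr_ge0.
move=> x; rewrite /flat; case: ifPn => [x0|_]; last first.
  by rewrite normr0 mulr_ge0// sumr_ge0// => i _; rewrite mulr_ge0.
rewrite horner_coef mulr_suml (le_trans (ler_norm_sum _ _ _))// mulr_suml.
apply: ler_sum => i _; rewrite -!mulrA normrM ler_wpM2l//.
set y := x^-1; have y0 : 0 < y by rewrite invr_gt0.
rewrite normrM normrX (gtr0_norm y0) (gtr0_norm x0) (gtr0_norm (expR_gt0 _)).
rewrite expRN -[x]invrK -/y ler_pdivrMr ?expR_gt0// mulrAC ler_pdivlMr//.
rewrite -exprSr mulrC -ler_pdivrMr ?ltr0n ?fact_gt0//.
by apply: le_trans (expR_ge1Dxn i (ltW y0)); rewrite lerDr.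
Qed.

Lemma flat_cvg0 P : flat P x @[x --> (0:R)] --> (0:R).
Proof.
have [C C0 PC] := flat_linear_bound P.
suff : `|flat P x| @[x --> (0:R)] --> (0:R) by move/norm_cvg0P.
apply: (@squeeze_cvgr _ _ _ _ (cst 0) (fun x => C * `|x|)).
- by near=> x; rewrite normr_ge0 PC.
- exact: cvg_cst.
- rewrite -[X in _ --> X](mulr0 C); apply: cvgMl_tmp.
  by have := @norm_continuous _ R^o 0; rewrite /continuous_at normr0.
Unshelve. all: by end_near. Qed.

(** At 0 the difference quotient of [flat P] is [flat ('X * P)], so the linear
    bound, applied to ['X * P], gives the derivative 0. *)
Lemma is_derive_flat P (x : R) :
  is_derive x (1:R) (flat P) (flat ('X^2 * (P - P^`()%R)) x).
Proof.
have [x0|x0|->] := ltrgt0P x.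
- apply: (@near_eq_is_derive R R R (fun x => P.[x^-1] * expR (- x^-1))).
    near=> y; rewrite /flat ifT//; near: y.
    by apply: lt_nbhsr.
  have xn0 : x != 0 by rewrite gt_eqF.
  have dV : is_derive x (1:R) (fun x => x^-1) (- x^-2).
    apply: is_derive_eq; first by apply: is_deriveV.
    by rewrite /GRing.scale/= mulr1.
  have dP := @is_derive1_comp _ (horner P) _ x _ _ (is_derive_poly P x^-1) dV.
  have dN : is_derive x (1:R) (fun x => - x^-1) (x^-2).
    by apply: is_derive_eq; rewrite opprK.
  have dE := @is_derive1_comp _ expR _ x _ _ (is_derive_expR (- x^-1)) dN.
  have := is_deriveM dP dE; move/is_derive_eq; apply.
  rewrite /flat x0 !hornerE /GRing.scale/= -exprVn; ring.
- apply: (@near_eq_is_derive R R R (cst 0)).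
    near=> y; rewrite flat_le0//; apply: ltW; near: y.
    by apply: lt_nbhsl.
  by apply: is_derive_eq; rewrite flat_le0// ltW.
- have E : (h^-1 *: ((flat P \o shift 0) (h *: 1) - flat P 0))
      @[h --> (0:R)^'] --> flat ('X^2 * (P - P^`()%R)) 0.
    rewrite !flat_le0//.
    apply: (@cvg_trans _ (flat ('X * P) x @[x --> (0:R)^'])).
      apply: near_eq_cvg; near=> h.
      rewrite /= /shift/= addr0 subr0 /GRing.scale/= mulr1.
      by rewrite /flat; case: ifP; rewrite ?mulr0// !hornerE.
    by apply: cvg_within_filter; exact: flat_cvg0.
  by apply: DeriveDef; [apply/cvg_ex; eexists; exact: E|exact: cvg_lim E].
Unshelve. all: by end_near. Qed.

Lemma smooth_flat P : smooth (flat P).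
Proof.
move=> n; elim: n P => //= n IH P; split.
  by move=> x; have [] := is_derive_flat P x.
by rewrite (derive1_eq (is_derive_flat P)).
Qed.

Definition theta (x : R) : R := flat 1 x.

Lemma theta_gt0E x : 0 < x -> theta x = expR (- x^-1).
Proof. by move=> x0; rewrite /theta /flat x0 hornerE mul1r. Qed.

Lemma theta_le0E x : x <= 0 -> theta x = 0. Proof. exact: flat_le0. Qed.

Lemma theta_ge0 x : 0 <= theta x.
Proof.
have [x0|x0] := leP x 0; first by rewrite theta_le0E.
by rewrite theta_gt0E// expR_ge0.
Qed.

Lemma theta_le1 x : theta x <= 1.
Proof.
have [x0|x0] := leP x 0; first by rewrite theta_le0E.
by rewrite theta_gt0E// -expR0 ler_expR oppr_le0 invr_ge0 ltW.
Qed.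

Lemma theta_scaled_cvg (x : R) : 0 < x ->
  theta (n.+1%:R * x) @[n --> \oo] --> (1:R).
Proof.
move=> x0.
rewrite (_ : (fun _ => _) = expR \o (fun n => - (n.+1%:R^-1 * x^-1))).
  rewrite -[X in _ --> X]expR0; apply: continuous_cvg; first exact: continuous_expR.
  rewrite -[X in _ --> X]oppr0; apply: cvgN; rewrite -[X in _ --> X](mul0r x^-1).
  exact: (cvgMr_tmp (@cvg_harmonic R)).
by apply/funext => n /=; rewrite theta_gt0E ?mulr_gt0// invfM.
Qed.

(** Dilating [theta] about each end point, instead of mollifying an indicator,
    yields smooth functions supported in ]a, b[ that increase to its
    indicator. *)
Definition bump1 (a b : R) (n : nat) (x : R) : R :=
  theta (n.+1%:R * (x - a)) * theta (n.+1%:R * (b - x)).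

Lemma smooth_bump1 a b n : smooth (bump1 a b n).
Proof.
move=> k; rewrite (_ : bump1 a b n = (fun x => theta (n.+1%:R * x + - (n.+1%:R * a)))
  \* (fun x => theta (- n.+1%:R * x + n.+1%:R * b))); last first.
  by apply/funext => x; rewrite /bump1/=; congr (theta _ * theta _); ring.
by apply: smooth_uptoM; apply: smooth_upto_affine; exact: smooth_flat.
Qed.

Lemma bump1_out a b n x : ~~ (a < x < b) -> bump1 a b n x = 0.
Proof.
rewrite negb_and -!leNgt => /orP[xa|bx]; rewrite /bump1.
  by rewrite theta_le0E ?mul0r// mulr_ge0_le0// subr_le0.
by rewrite [X in _ * X]theta_le0E ?mulr0// mulr_ge0_le0// subr_le0.
Qed.

Lemma bump1_ge0 a b n x : 0 <= bump1 a b n x.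
Proof. by rewrite mulr_ge0// theta_ge0. Qed.

Lemma bump1_le1 a b n x : bump1 a b n x <= 1.
Proof. by rewrite /bump1 mulr_ile1// ?theta_ge0// theta_le1. Qed.

Lemma bump1_cvg a b x : a < x < b -> bump1 a b n x @[n --> \oo] --> (1:R).
Proof.
move=> /andP[ax xb]; rewrite -[X in _ --> X](mulr1 1).
by apply: cvgM; apply: theta_scaled_cvg; rewrite subr_gt0.
Qed.

End flat.

(** * Test functions supported in boxes *)

Section product_test.
Context {R : realType} {d : nat}.
Implicit Types f : 'I_d -> R -> R.

Definition prodf f (x : 'rV[R]_d) : R := \prod_i f i (x 0 i).

Lemma continuous_prodf f : (forall i, continuous (f i)) -> continuous (prodf f).
Proof.
move=> fc.
pose F (s : seq 'I_d) (y : 'rV[R]_d) : R := \prod_(i <- s) f i (y 0 i).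
suff : forall s, continuous (F s) by apply.
elim=> [|i s IH].
  rewrite (_ : F [::] = cst 1); first exact: cst_continuous.
  by apply/funext => y; rewrite /F big_nil.
rewrite (_ : F (i :: s) = (fun y : 'rV[R]_d => f i (y 0 i)) \* F s); last first.
  by apply/funext => y; rewrite /F big_cons.
move=> x; apply: continuousM; last exact: IH.
apply: (@continuous_comp _ _ _ (fun y : 'rV[R]_d => y 0 i) (f i)).
  exact: coord_continuous.
exact: fc.
Qed.

(** Along the i-th axis only the i-th factor varies, so the partial derivative
    is again a product of functions of one variable; this closure is what
    makes the iterated regularity [Cn] provable by induction. *)
Lemma is_derive_prodf f i (x : 'rV[R]_d) : derivable (f i) (x 0 i) 1 ->
  is_derive x (delta_mx 0 i) (prodf f)
    (prodf (fun j => if j == i then derive1 (f i) else f j) x).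
Proof.
move=> df; set c := \prod_(j | j != i) f j (x 0 j).
have E : (h^-1 *: ((prodf f \o shift x) (h *: delta_mx 0 i) - prodf f x))
    @[h --> (0:R)^'] --> prodf (fun j => if j == i then derive1 (f i) else f j) x.
  rewrite [X in _ --> X]/prodf (bigD1 i)//= eqxx.
  rewrite (eq_bigr (fun j => f j (x 0 j))) -/c; last by move=> j /negbTE ->.
  rewrite (_ : (fun _ => _) = fun h =>
    h^-1 *: ((f i \o shift (x 0 i)) (h *: 1) - f i (x 0 i)) * c).
    by apply: cvgMr_tmp; rewrite derive1E; exact: df.
  apply/funext => h; rewrite /prodf/= (bigD1 i)//= [X in _ - X](bigD1 i)//= -/c.
  rewrite (eq_bigr (fun j => f j (x 0 j))) -/c; last first.
    by move=> j ji; rewrite !mxE (negbTE ji) andbF mulr0 add0r.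
  by rewrite !mxE !eqxx -mulrBl /GRing.scale/= mulrA.
by apply: DeriveDef; [apply/cvg_ex; eexists; exact: E|exact: cvg_lim E].
Qed.

Lemma Cn_prodf f : (forall i, smooth (f i)) -> forall n, Cn n (prodf f).
Proof.
move=> + n; elim: n f => [|n IH] f fs; split=> //; try by
  apply: continuous_prodf => i; exact: smooth_continuous.
move=> i.
have D x := @is_derive_prodf f i x (@smooth_derivable _ _ (fs i) (x 0 i)).
split; first by move=> x; case: (D x).
rewrite (_ : partial i _ = prodf (fun j => if j == i then derive1 (f i) else f j)).
  by apply: IH => j; case: ifP => // _; exact: smooth_derive1.
by apply/funext => x; rewrite /partial; case: (D x).
Qed.

Definition bump (a b : 'rV[R]_d) (n : nat) : 'rV[R]_d -> R :=
  prodf (fun i => bump1 (a 0 i) (b 0 i) n).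

Definition obox (a b : 'rV[R]_d) : set 'rV[R]_d :=
  [set x | forall i, a 0 i < x 0 i < b 0 i].
Definition cbox (a b : 'rV[R]_d) : set 'rV[R]_d :=
  [set x | forall i, a 0 i <= x 0 i <= b 0 i].

Lemma cbox_compact a b : compact (cbox a b).
Proof.
rewrite (_ : cbox a b = [set x | forall i, `[a 0 i, b 0 i]%classic (x ord0 i)]).
  apply: (@rV_compact _ _ (fun i => `[a 0 i, b 0 i]%classic)) => i; exact: segment_compact.
by apply/seteqP; split=> x /= h i; have := h i; rewrite in_itv.
Qed.

Lemma obox_cbox a b : obox a b `<=` cbox a b.
Proof. by move=> x h i; have /andP[/ltW -> /ltW ->] := h i. Qed.

Lemma bump_out a b n x : ~ obox a b x -> bump a b n x = 0.
Proof.
move=> /existsNP[i /negP h]; rewrite /bump /prodf (bigD1 i)//=.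
by rewrite bump1_out ?mul0r.
Qed.

Lemma bump_ge0 a b n x : 0 <= bump a b n x.
Proof. by apply: prodr_ge0 => i _; exact: bump1_ge0. Qed.

Lemma bump_le1 a b n x : bump a b n x <= 1.
Proof. by apply: prodr_ile1 => i _; rewrite bump1_ge0 bump1_le1. Qed.

Lemma bump_cvg a b x : obox a b x -> bump a b n x @[n --> \oo] --> (1:R).
Proof.
move=> abx; rewrite /bump /prodf.
pose F (s : seq 'I_d) (n : nat) : R := \prod_(i <- s) bump1 (a 0 i) (b 0 i) n (x 0 i).
suff : forall s, F s n @[n --> \oo] --> (1:R) by apply.
elim=> [|i s IH].
  rewrite (_ : F [::] = cst 1); first exact: cvg_cst.
  by apply/funext => m; rewrite /F big_nil.
rewrite (_ : F (i :: s) = (fun m => bump1 (a 0 i) (b 0 i) m (x 0 i)) \* F s); last first.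
  by apply/funext => m; rewrite /F big_cons.
by rewrite -[X in _ --> X]mulr1; apply: cvgM => //; exact: bump1_cvg.
Qed.

Lemma test_fun_bump (Om : set 'rV[R]_d) a b n :
  cbox a b `<=` Om -> test_fun Om (bump a b n).
Proof.
move=> abOm; split; first by apply: Cn_prodf => i; exact: smooth_bump1.
exists (cbox a b); split=> //; first exact: cbox_compact.
by move=> x nx; apply: bump_out => /obox_cbox.
Qed.

End product_test.

(** * Boxes and Lebesgue measure on row vectors *)

Section borel_row.
Context {R : realType} {d : nat}.
Local Notation Rd := 'rV[R]_d.

Lemma measurable_rowE : @measurable _ Rd = <<s open >>.
Proof. by []. Qed.

Lemma continuous_measurable_row (f : Rd -> R) (A : set Rd) :
  measurable A -> continuous f -> measurable_fun A f.
Proof.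
move=> mA fc; apply: measurable_funTS.
apply: (measurability _ (RGenOpens.measurableE R)).
move=> _ [_ [a [b ->]] <-]; rewrite setTI; apply: open_measurable_row.
have oU : open `]a, b[%classic by exact: interval_open.
exact: (proj1 (continuousP _) fc _ oU).
Qed.

Lemma obox_open (a b : Rd) : open (obox a b).
Proof.
rewrite openE => x /= abx; rewrite /interior.
have H (i : 'I_d) : \forall y \near x, a 0 i < (y : Rd) 0 i < b 0 i.
  have /andP[ax xb] := abx i.
  have := @coord_continuous R 1 d 0 i x.
  by move=> /(_ `]a 0 i, b 0 i[%classic); apply; rewrite /=;
    apply: open_nbhs_nbhs; split; [exact: interval_open|rewrite /= in_itv/= ax].
exact: filter_forall H.
Qed.

Lemma cbox_measurable (a b : Rd) : measurable (cbox a b).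
Proof.
rewrite -[X in measurable X]setCK; apply: measurableC; apply: open_measurable_row.
apply: closed_openC; apply: compact_closed; last exact: cbox_compact.
exact: norm_hausdorff.
Qed.

(** The boxes with rational vertices whose closure stays inside U suffice. *)
Lemma open_bigcup_obox (U : set Rd) : open U ->
  exists (D : set nat) (a b : nat -> Rd),
    U = \bigcup_(n in D) obox (a n) (b n) /\
    forall n, D n -> cbox (a n) (b n) `<=` U.
Proof.
move=> oU.
pose r (n : nat) : 'rV[rat]_d * 'rV[rat]_d := odflt (0, 0) (unpickle n).
pose a n : Rd := map_mx ratr (r n).1.
pose b n : Rd := map_mx ratr (r n).2.
exists [set n | cbox (a n) (b n) `<=` U], a, b; split=> //.
apply/seteqP; split=> [x Ux|x [n /= abU /obox_cbox]]; last exact: abU.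
have /nbhs_ballP[e /= e0 eU] : nbhs x U by apply: open_nbhs_nbhs.
have /choice[p hp] : forall i, exists q : rat, x 0 i - e < ratr q < x 0 i.
  move=> i; have /rat_in_itvoo[q] : x 0 i - e < x 0 i by lra.
  by rewrite in_itv /= => ?; exists q.
have /choice[q hq] : forall i, exists q : rat, x 0 i < ratr q < x 0 i + e.
  move=> i; have /rat_in_itvoo[q] : x 0 i < x 0 i + e by lra.
  by rewrite in_itv /= => ?; exists q.
have rE : r (pickle (\row_i p i, \row_i q i)) = (\row_i p i, \row_i q i).
  by rewrite /r pickleK.
exists (pickle (\row_i p i, \row_i q i)); rewrite /= /a /b rE /=.
  move=> y yab; apply: eU; split=> // i j; rewrite (ord1 i).
  have := yab j; rewrite !mxE => /andP[py yq].
  have /andP[p1 p2] := hp j; have /andP[q1 q2] := hq j.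
  by rewrite /ball/= ltr_norml; apply/andP; split; lra.
move=> i; rewrite !mxE.
by have /andP[_ ->] := hp i; have /andP[-> _] := hq i.
Qed.

Lemma measurable_oboxE :
  @measurable _ Rd = <<s [set A | exists a b, A = obox a b] >>.
Proof.
rewrite measurable_rowE; apply/seteqP; split.
  apply: smallest_sub; first exact: smallest_sigma_algebra.
  move=> U /open_bigcup_obox[D [a [b [-> _]]]]; rewrite bigcup_mkcond.
  apply: sigma_algebra_bigcup => n; case: ifP => _; last exact: sigma_algebra0.
  by apply: sub_sigma_algebra; exists (a n), (b n).
apply: smallest_sub; first exact: smallest_sigma_algebra.
by move=> _ [a [b ->]]; apply: sub_sigma_algebra; exact: obox_open.
Qed.

Lemma oboxI (a b a' b' : Rd) :
  obox a b `&` obox a' b' = obox (\row_i Num.max (a 0 i) (a' 0 i))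
    (\row_i Num.min (b 0 i) (b' 0 i)).
Proof.
apply/seteqP; split=> [x [h h'] i|x h]; last split=> i.
- by have := h i; have := h' i; rewrite !mxE gt_max lt_min => /andP[-> ->] /andP[-> ->].
- by have := h i; rewrite !mxE gt_max lt_min => /andP[/andP[-> _] /andP[-> _]].
- by have := h i; rewrite !mxE gt_max lt_min => /andP[/andP[_ ->] /andP[_ ->]].
Qed.

Lemma cboxS (a b a' b' : Rd) :
  cbox (\row_i Num.max (a 0 i) (a' 0 i)) (\row_i Num.min (b 0 i) (b' 0 i))
    `<=` cbox a b.
Proof.
move=> x h i; have := h i.
by rewrite !mxE ge_max le_min => /andP[/andP[-> _] /andP[-> _]].
Qed.

End borel_row.

(** A box splits off its first coordinate, in step with the recursion that
    defines [leb]. *)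
Lemma preimage_cons_row_cbox {R : realType} (n : nat) (a b : 'rV[R]_(1 + n)) :
  @cons_row R n @^-1` cbox a b =
    `[a 0 (lshift n 0), b 0 (lshift n 0)]%classic `*` cbox (rsubmx a) (rsubmx b).
Proof.
apply/seteqP; split=> -[x y] /=.
  move=> h; split=> [|i].
    by have := h (lshift n 0); rewrite /cons_row row_mxEl !mxE eqxx mulr1n in_itv.
  by have := h (rshift 1 i); rewrite /cons_row row_mxEr !mxE.
move=> [] /=; rewrite in_itv /= => hx hy i.
rewrite /cons_row -[i]fintype.splitK; case: (fintype.split i) => j /=.
  by rewrite row_mxEl !mxE (ord1 j) eqxx mulr1n.
by have := hy j; rewrite row_mxEr !mxE.
Qed.

Lemma leb_cbox_lty {R : realType} (n : nat) (a b : 'rV[R]_n) :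
  (leb n (cbox a b) < +oo)%E.
Proof.
elim: n a b => [|n IH] a b.
  by rewrite /= diracE; case: (_ \in _); exact: ltry.
rewrite /= /leb_cons /pushforward.
rewrite preimage_cons_row_cbox.
rewrite product_measure1E//; last exact: cbox_measurable.
rewrite lte_mul_pinfty// ge0_fin_numE// [ltLHS]lebesgue_measure_itv/=.
by case: ifP => _; rewrite ?ltry// -EFinB ltry.
Qed.

Lemma bounded_sub_cbox {R : realType} (n : nat) (A : set 'rV[R]_n) :
  bounded_set A -> exists c, A `<=` cbox (- c) c.
Proof.
move=> [M [Mreal AM]]; exists (const_mx (M + 1)).
have M1 : M < M + 1 by rewrite ltrDl.
move=> x /(AM _ M1) /= h i; rewrite !mxE -ler_norml; apply: le_trans h.
have /mapP[j Hj ->] : `|x ord0 i| \in [seq `|x y.1 y.2| | y : 'I_1 * 'I_n].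
  by apply/mapP; exists (ord0, i) => //=; rewrite mem_enum.
by rewrite [leRHS]/Num.norm /= mx_normrE; apply/bigmax_geP; right => /=; exists j.
Qed.

Lemma leb_bounded_lty {R : realType} (n : nat) (A : set 'rV[R]_n) :
  measurable A -> bounded_set A -> (leb n A < +oo)%E.
Proof.
move=> mA /bounded_sub_cbox[c Ac].
apply: le_lt_trans (leb_cbox_lty (- c) c).
by apply: le_measure; rewrite ?inE//; exact: cbox_measurable.
Qed.

(** * Functions orthogonal to all test functions *)

Section fundamental_lemma.
Context {R : realType} {d : nat}.
Local Notation Rd := 'rV[R]_d.
Local Notation mu := (leb d).
Variables (Om : set Rd) (h : Rd -> R).
Hypothesis oOm : open Om.
Hypothesis hint : mu.-integrable Om (EFin \o h).
Hypothesis htest : forall phi, test_fun Om phi -> ip Om h phi = 0.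

Let mOm : measurable Om. Proof. exact: open_measurable_row. Qed.

Let mobox (a b : Rd) : measurable (obox a b).
Proof. by apply: open_measurable_row; exact: obox_open. Qed.

Let continuous_bump (a b : Rd) n : continuous (bump a b n).
Proof.
by apply: continuous_prodf => i; apply: smooth_continuous; exact: smooth_bump1.
Qed.

(** The bumps of the box are dominated by 1 and converge pointwise to its
    indicator. *)
Let integral_obox (a b : Rd) : cbox a b `<=` Om ->
  (\int[mu]_(x in obox a b) (h x)%:E = 0)%E.
Proof.
move=> abOm.
have mh : measurable_fun Om h by apply/measurable_EFinP; case/integrableP : hint.
have mf n : measurable_fun Om (fun x => (h x * bump a b n x)%:E).
  apply/measurable_EFinP/measurable_funM => //.
  exact: continuous_measurable_row.
have bnd n x : `|h x * bump a b n x| <= `|h x|.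
  by rewrite normrM (ger0_norm (bump_ge0 _ _ _ _)) ler_piMr// bump_le1.
pose f_ n x := (h x * bump a b n x)%:E.
pose f := (EFin \o h) \_ (obox a b).
have [] // := @dominated_convergence _ _ _ mu Om mOm f_ f (fun x => `|h x|%:E) mf.
- apply/(measurable_restrict _ (mobox a b) mOm); apply: measurable_funS mOm _ _ => //.
  exact/measurable_EFinP.
- apply: aeW => x _; rewrite /f_ /f /restrict; case: ifPn => [|];
    rewrite ?(inE, notin_setE) => abx.
    apply: cvg_EFin; first by near=> n.
    rewrite -[X in _ --> X]mulr1; apply: cvgM; first exact: cvg_cst.
    exact: bump_cvg.
  rewrite (_ : (fun _ => _) = cst 0%E); first exact: cvg_cst.
  by apply/funext => n; rewrite bump_out// mulr0.
- exact: integrable_norm hint.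
- by apply: aeW => x n _; rewrite lee_fin.
move=> _ _; rewrite (_ : [sequence _]_n = cst 0%E); last first.
  apply/funext => n; have := htest (test_fun_bump n abOm).
  rewrite /ip /Rintegral => h0.
  have fin : (\int[mu]_(x in Om) (h x * bump a b n x)%:E)%E \is a fin_num.
    apply: integrable_fin_num => //; apply: le_integrable hint => //.
    by move=> x _ /=; rewrite lee_fin.
  by rewrite /= /f_ -(fineK fin) h0.
move=> cv; have := cvg_lim (@ereal_hausdorff R) cv.
rewrite lim_cst// => f0; rewrite [RHS]f0 /f -integral_mkcondr.
by congr (integral _ _ _); apply/esym/setIidr => x /obox_cbox /abOm.
Unshelve. all: by end_near. Qed.

Let integral_obox_measurable (a b : Rd) (A : set Rd) : cbox a b `<=` Om ->
  measurable A -> (\int[mu]_(x in A `&` obox a b) (h x)%:E = 0)%E.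
Proof.
move=> abOm mA.
have iB : mu.-integrable (obox a b) (EFin \o h).
  by apply: integrableS hint => // x /obox_cbox /abOm.
rewrite measurable_oboxE in mA.
pose P (A : set Rd) := (\int[mu]_(x in A `&` obox a b) (h x)%:E = 0)%E.
apply: (@dynkin_induction _ Rd _ P measurable_oboxE _ _ _ _ _ A mA).
- by move=> X Y /= [a1 [b1 ->]] [a2 [b2 ->]]; eexists; eexists; exact: oboxI.
- by rewrite /P setTI; exact: integral_obox.
- move=> _ [a1 [b1 ->]]; rewrite /P setIC oboxI; apply: integral_obox.
  by apply: subset_trans abOm; exact: cboxS.
- move=> S mS PS; rewrite /P.
  have := integral_obox abOm; rewrite -{1}[obox a b]setTI -(setUv S) setIUl.
  rewrite integral_setU//; last 4 first.
  + exact: measurableI.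
  + by apply: measurableI => //; exact: measurableC.
  + rewrite -setIUl setUv setTI; exact: measurable_int iB.
  + by apply/disj_setPS => x [[Sx _] [nSx _]].
  by rewrite PS add0e.
- move=> F mF tF PF; rewrite /P setI_bigcupl.
  rewrite integral_bigcup//.
  + by rewrite eseries0// => n _ _; exact: PF.
  + exact: trivIset_setIr.
  + by move=> k; exact: measurableI.
  + apply: integrableS iB => //; last by rewrite -setI_bigcupl; exact: subIsetr.
    by apply: bigcup_measurable => k _; exact: measurableI.
Qed.

(** The integral of h vanishes on every box whose closure lies in the domain,
    hence, by Dynkin's lemma, on every measurable part of such a box, which
    forces h = 0 almost everywhere on it; countably many boxes fill the
    domain. *)
Theorem ae_zero_of_test_fun : aeq Om h (cst 0).
Proof.
have [D [a [b [OmE abOm]]]] := open_bigcup_obox oOm.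
have H n : \forall x \ae mu, D n -> obox (a n) (b n) x -> h x = 0.
  have [Dn|nDn] := pselect (D n); last by apply: aeW.
  have : ae_eq mu (obox (a n) (b n)) (EFin \o h) (cst 0%E).
    apply: integral_ae_eq => //.
      by apply: integrableS hint => // x /obox_cbox /abOm; apply.
    move=> E EB mE; rewrite integral0 -(setIidl EB).
    by apply: integral_obox_measurable => //; exact: abOm.
  by apply: filterS => x /= H _ /H [].
have := ae_foralln H; apply: filterS => x Hx.
by rewrite {1}OmE => -[n Dn abx]; exact: Hx abx.
Qed.

End fundamental_lemma.

(** * Square-integrable functions and weak divergences *)

Section L2_space.
Context {R : realType} {d : nat}.
Local Notation Rd := 'rV[R]_d.
Local Notation mu := (leb d).
Variable Om : set Rd.
Hypothesis mOm : measurable Om.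
Implicit Types u g q : Rd -> R.

(** By |u g| <= u^2 + g^2. *)
Lemma L2M_integrable u g : L2 Om u -> L2 Om g ->
  mu.-integrable Om (fun x => (u x * g x)%:E).
Proof.
move=> [mu_ iu] [mg ig].
apply: le_integrable (integrableD mOm iu ig) => //.
  exact/measurable_EFinP/measurable_funM.
move=> x _ /=; rewrite lee_fin [leRHS]ger0_norm ?addr_ge0 ?sqr_ge0//.
by rewrite ler_norml; apply/andP; split; nra.
Qed.

Lemma L2_comb (a : R) u g : L2 Om u -> L2 Om g -> L2 Om (a *: u + g).
Proof.
move=> Lu Lg; have [mu_ iu] := Lu; have [mg ig] := Lg; split.
  by apply: measurable_funD => //; exact: measurable_funM.
have := integrableD mOm (integrableD mOm (integrableZl mOm (a ^+ 2) iu) ig)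
  (integrableZl mOm (a *+ 2) (L2M_integrable Lu Lg)).
apply: eq_integrable => // x _ /=; rewrite -!EFinM -!EFinD; congr EFin.
by rewrite !fctE /GRing.scale/=; ring.
Qed.

Lemma L2_0 : L2 Om (0 : Rd -> R).
Proof.
split; first exact: measurable_cst.
rewrite (_ : (fun _ => _) = cst 0%E); first exact: integrable0.
by apply/funext => x; rewrite fctE expr0n.
Qed.

Lemma L2Z (a : R) u : L2 Om u -> L2 Om (a *: u).
Proof. by move=> Lu; rewrite -[a *: u]addr0; apply: L2_comb => //; exact: L2_0. Qed.

Lemma L2D u g : L2 Om u -> L2 Om g -> L2 Om (u + g).
Proof. by move=> Lu Lg; rewrite -[u]scale1r; exact: L2_comb. Qed.

Lemma L2B u g : L2 Om u -> L2 Om g -> L2 Om (u - g).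
Proof. by move=> Lu Lg; rewrite addrC -scaleN1r; exact: L2_comb. Qed.

Lemma L2_sum (I : Type) (s : seq I) (F : I -> Rd -> R) :
  (forall i, L2 Om (F i)) -> L2 Om (\sum_(i <- s) F i).
Proof. by move=> LF; apply: big_ind => //; [exact: L2_0|exact: L2D]. Qed.

Lemma ipC u g : ip Om u g = ip Om g u.
Proof. by apply: eq_Rintegral => x _; rewrite mulrC. Qed.

Lemma ip_comb (a : R) u g q : L2 Om u -> L2 Om g -> L2 Om q ->
  ip Om (a *: u + g) q = a * ip Om u q + ip Om g q.
Proof.
move=> Lu Lg Lq; rewrite /ip -RintegralZl//; last exact: L2M_integrable.
rewrite -RintegralD//; last 2 first.
- by have := integrableZl mOm a (L2M_integrable Lu Lq).
- exact: L2M_integrable.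
by apply: eq_Rintegral => x _; rewrite !fctE /GRing.scale/=; ring.
Qed.

Lemma ip0 q : ip Om 0 q = 0.
Proof.
rewrite /ip -[RHS](mul0r (fine (mu Om))) -Rintegral_cst//.
by apply: eq_Rintegral => x _; exact: mul0r.
Qed.

Lemma ipZ (a : R) u q : L2 Om u -> L2 Om q -> ip Om (a *: u) q = a * ip Om u q.
Proof.
by move=> Lu Lq; rewrite -[a *: u]addr0 ip_comb ?ip0 ?addr0//; exact: L2_0.
Qed.

Lemma ipD u g q : L2 Om u -> L2 Om g -> L2 Om q ->
  ip Om (u + g) q = ip Om u q + ip Om g q.
Proof. by move=> Lu Lg Lq; rewrite -[u]scale1r ip_comb// scale1r mul1r. Qed.

Lemma ipB u g q : L2 Om u -> L2 Om g -> L2 Om q ->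
  ip Om (u - g) q = ip Om u q - ip Om g q.
Proof.
by move=> Lu Lg Lq; rewrite addrC -scaleN1r ip_comb// mulN1r addrC.
Qed.

Lemma ip_sum (I : Type) (s : seq I) (F : I -> Rd -> R) q :
  (forall i, L2 Om (F i)) -> L2 Om q ->
  ip Om (\sum_(i <- s) F i) q = \sum_(i <- s) ip Om (F i) q.
Proof.
move=> LF Lq; elim: s => [|i s IH]; first by rewrite !big_nil ip0.
by rewrite !big_cons ipD ?IH//; exact: L2_sum.
Qed.

Lemma ip_aeq u u' q : L2 Om u -> L2 Om u' -> L2 Om q ->
  aeq Om u u' -> ip Om u q = ip Om u' q.
Proof.
move=> [mu_ _] [mu' _] [mq _] uu'; congr fine.
apply: ae_eq_integral => //; try exact/measurable_EFinP/measurable_funM.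
by move: uu'; apply: filterS => x /[apply] ->.
Qed.

Lemma ip_self0 u : L2 Om u -> ip Om u u = 0 -> aeq Om u 0.
Proof.
move=> Lu; have [mu_ iu] := Lu; rewrite /ip /Rintegral => u0.
have : (\int[mu]_(x in Om) `|(u x * u x)%:E| = 0)%E.
  rewrite -[RHS]/(0%:E) -u0 fineK.
    by apply: eq_integral => x _; rewrite gee0_abs// lee_fin -expr2 sqr_ge0.
  by apply: integrable_fin_num => //; exact: L2M_integrable.
move=> /ae_eq_integral_abs h.
have {}h : ae_eq mu Om (fun x => (u x * u x)%:E) (cst 0%E).
  by apply/h => //; exact/measurable_EFinP/measurable_funM.
by move: h; apply: filterS => x /[apply] -[/eqP]; rewrite mulf_eq0 orbb => /eqP.
Qed.

Lemma ip_ge0 u : 0 <= ip Om u u.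
Proof. by apply: Rintegral_ge0 => x _; rewrite -expr2 sqr_ge0. Qed.

Hypothesis bOm : bounded_set Om.

Lemma continuous_L2 u : continuous u -> L2 Om u.
Proof.
move=> uc; split; first exact: continuous_measurable_row.
have u2c : continuous (fun x => u x ^+ 2).
  by move=> x; apply: (@continuousM _ _ u u) => //; exact: uc.
have [c Ac] := bounded_sub_cbox bOm.
apply: measurable_bounded_integrable => //.
- exact: leb_bounded_lty.
- exact: continuous_measurable_row.
- have /compact_bounded[M [Mr KM]] :
      compact ((fun x => u x ^+ 2) @` cbox (- c) c).
    apply: continuous_compact; last exact: cbox_compact.
    exact: continuous_subspaceT.
  by exists M; split=> // y My x Omx; apply: (KM y My); exists x => //; exact: Ac.
Qed.

Lemma L2_integrable u : L2 Om u -> mu.-integrable Om (EFin \o u).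
Proof.
move=> Lu; have L1 : L2 Om (cst 1) by apply: continuous_L2; exact: cst_continuous.
by have := L2M_integrable Lu L1; apply: eq_integrable => // x _ /=; rewrite mulr1.
Qed.

End L2_space.

Section weak_divergence.
Context {R : realType} {d : nat}.
Local Notation Rd := 'rV[R]_d.
Variable Om : set Rd.
Hypothesis oOm : open Om.
Hypothesis bOm : bounded_set Om.
Implicit Types v w : Rd -> Rd.

Let mOm : measurable Om. Proof. exact: open_measurable_row. Qed.

Lemma test_fun_L2 phi : test_fun Om phi -> L2 Om phi.
Proof. by move=> [/(_ 0%N)[? _] _]; exact: continuous_L2. Qed.

Lemma test_fun_partial_L2 phi i : test_fun Om phi -> L2 Om (partial i phi).
Proof. by move=> [/(_ 1%N)[_ /(_ i)[_ [? _]]] _]; exact: continuous_L2. Qed.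

(** [div] picks an arbitrary weak divergence; this makes the choice immaterial
    almost everywhere, which is what makes [div] linear. *)
Lemma is_weak_div_unique v g g' :
  is_weak_div Om v g -> is_weak_div Om v g' -> aeq Om g g'.
Proof.
move=> [Lg vg] [Lg' vg'].
have : aeq Om (g - g') (cst 0).
  apply: ae_zero_of_test_fun => //; first by apply: L2_integrable => //; exact: L2B.
  move=> phi tphi; rewrite ipB//; last exact: test_fun_L2.
  by apply/eqP; rewrite subr_eq0 -eqr_opp -vg// -vg'.
by apply: filterS => x /[apply] /eqP; rewrite subr_eq0 => /eqP.
Qed.

Lemma div_spec v : Hdiv Om v -> is_weak_div Om v (div Om v).
Proof. by move=> [_ vg]; exact: getPex. Qed.

Lemma div_L2 v : Hdiv Om v -> L2 Om (div Om v).
Proof. by move=> /div_spec[]. Qed.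

Lemma comp_comb (a : R) v w i :
  Defs.comp (a *: v + w) i = a *: Defs.comp v i + Defs.comp w i.
Proof.
apply/funext => x; rewrite /Defs.comp.
by rewrite -[LHS]/((a *: v x + w x) 0 i) !mxE.
Qed.

Lemma is_weak_div_comb (a : R) v w g g' : Hdiv Om v -> Hdiv Om w ->
  is_weak_div Om v g -> is_weak_div Om w g' ->
  is_weak_div Om (a *: v + w) (a *: g + g').
Proof.
move=> [Lv _] [Lw _] [Lg vg] [Lg' wg']; split; first exact: L2_comb.
move=> phi tphi; rewrite ip_comb//; last exact: test_fun_L2.
rewrite opprD -mulrN -vg// -wg'// mulr_sumr -big_split/=; apply: eq_bigr => i _.
rewrite -ip_comb//; last exact: test_fun_partial_L2.
by rewrite comp_comb.
Qed.

Lemma Hdiv_comb (a : R) v w : Hdiv Om v -> Hdiv Om w -> Hdiv Om (a *: v + w).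
Proof.
move=> Hv Hw; split; last first.
  by eexists; apply: is_weak_div_comb => //; exact: div_spec.
by move=> i; rewrite comp_comb; apply: L2_comb => //; [case: Hv|case: Hw].
Qed.

Lemma div_comb (a : R) v w : Hdiv Om v -> Hdiv Om w ->
  aeq Om (div Om (a *: v + w)) (a *: div Om v + div Om w).
Proof.
move=> Hv Hw; apply: is_weak_div_unique; first exact/div_spec/Hdiv_comb.
by apply: is_weak_div_comb => //; exact: div_spec.
Qed.

Lemma div_add v w : Hdiv Om v -> Hdiv Om w ->
  aeq Om (div Om (v + w)) (div Om v + div Om w).
Proof. by move=> Hv Hw; have := div_comb 1 Hv Hw; rewrite !scale1r. Qed.

Lemma comp0 i : Defs.comp (0 : Rd -> Rd) i = 0.
Proof. by apply/funext => x; rewrite /Defs.comp -[LHS]/((0 : Rd) 0 i) mxE. Qed.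

Lemma is_weak_div0 : is_weak_div Om 0 0.
Proof.
split; first exact: L2_0.
move=> phi _; rewrite ip0// oppr0 big1// => i _.
by rewrite comp0 ip0.
Qed.

Lemma Hdiv0 : Hdiv Om (0 : Rd -> Rd).
Proof.
split; last by exists 0; exact: is_weak_div0.
by move=> i; rewrite comp0; exact: L2_0.
Qed.

Lemma div_opp v : Hdiv Om v -> aeq Om (div Om (- v)) (- div Om v).
Proof.
move=> Hv.
have E : - v = -1 *: v + 0 by rewrite addr0 scaleN1r.
have E' : - div Om v = -1 *: div Om v + 0 by rewrite addr0 scaleN1r.
rewrite E' {1}E; apply: (@is_weak_div_unique (-1 *: v + 0)).
  exact: (div_spec (Hdiv_comb _ Hv Hdiv0)).
exact: (is_weak_div_comb _ Hv Hdiv0 (div_spec Hv) is_weak_div0).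
Qed.

Lemma H10v_Hdiv v : H10v Om v -> Hdiv Om v.
Proof.
move=> Hv; split=> [i|]; first by have [[]] := Hv i.
have /choice[g gP] : forall i, exists g, is_weak_partial Om i (Defs.comp v i) g.
  by move=> i; have [[_ h] _] := Hv i; exact: h.
exists (\sum_i g i); split; first by apply: L2_sum => // i; case: (gP i).
move=> phi tphi; rewrite ip_sum//; last 2 first.
- by move=> i; case: (gP i).
- exact: test_fun_L2.
by rewrite -sumrN; apply: eq_bigr => i _; case: (gP i) => _ ->.
Qed.

End weak_divergence.

(** * Projection on a finite-dimensional space *)

Section projection.
Context {R : realType} {d : nat}.
Local Notation Rd := 'rV[R]_d.
Variable Om : set Rd.
Hypothesis mOm : measurable Om.
Variable S : set (Rd -> R).
Hypothesis subS : is_subspace S.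
Hypothesis SL2 : S `<=` L2 Om.
(** Finite dimension is expressed by coordinates, [rep u c] reading that u has
    coordinates c. A relation, rather than a map, spares the choice of
    coordinates when they are not unique, as for polynomials on simplices that
    might be degenerate. *)
Variables (F : finType) (rep : (Rd -> R) -> (F -> R) -> Prop).
Hypothesis rep_ex : forall u, S u -> exists c, rep u c.
Hypothesis rep_comb : forall (a : R) u v c c',
  rep u c -> rep v c' -> rep (a *: u + v) (a *: c + c').
Hypothesis rep_zero : rep 0 0.
Hypothesis rep0 : forall u, rep u 0 -> aeq Om u 0.

Let subspace_sum n (a : 'I_n -> R) (s : 'I_n -> Rd -> R) :
  (forall i, S (s i)) -> S (\sum_i a i *: s i).
Proof.
move=> Ss; apply: big_ind => //; first by case: subS.
  by move=> u v Su Sv; rewrite -[u]scale1r; apply: subS.2.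
by move=> i _; rewrite -[_ *: _]addr0; apply: subS.2 => //; case: subS.
Qed.

Let rep_sum n (a : 'I_n -> R) (s : 'I_n -> Rd -> R) (c : 'I_n -> F -> R) :
  (forall i, rep (s i) (c i)) -> rep (\sum_i a i *: s i) (\sum_i a i *: c i).
Proof.
move=> sc; elim/big_rec2: _ => // i u v _ uv; exact: rep_comb.
Qed.

Let orthonormal n (s : 'I_n -> Rd -> R) :=
  (forall i, S (s i)) /\ forall i j, ip Om (s i) (s j) = (i == j)%:R.

Let ip_orthonormal n (s : 'I_n -> Rd -> R) (a : 'I_n -> R) j :
  orthonormal s -> ip Om (\sum_i a i *: s i) (s j) = a j.
Proof.
move=> [Ss os]; rewrite ip_sum//; last 2 first.
- by move=> i; apply: L2Z => //; exact/SL2/Ss.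
- exact/SL2/Ss.
rewrite (bigD1 j)//= big1 => [|i ij]; rewrite ipZ ?os//; try exact/SL2/Ss.
  by rewrite eqxx mulr1 addr0.
by rewrite (negbTE ij) mulr0.
Qed.

(** A longer family would have linearly dependent coordinates, hence a
    nontrivial combination that vanishes almost everywhere, against
    orthonormality. *)
Lemma orthonormal_size n (s : 'I_n -> Rd -> R) : orthonormal s -> (n <= #|F|)%N.
Proof.
move=> os; have [Ss _] := os; rewrite leqNgt; apply/negP => Fn.
have /choice[c sc] : forall i, exists c, rep (s i) c by move=> i; exact: rep_ex.
pose C : 'M[R]_(n, #|F|) := \matrix_(i, j) c i (enum_val j).
have : kermx C != 0.
  rewrite -mxrank_eq0 mxrank_ker -lt0n subn_gt0.
  by apply: leq_ltn_trans Fn; exact: rank_leq_col.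
move=> /rowV0Pn[a /sub_kermxP aC /negP]; apply; apply/eqP/rowP => j.
rewrite mxE -(@ip_orthonormal _ s (fun i => a 0 i) j os).
have c0 : \sum_i a 0 i *: c i = 0.
  apply/funext => f; rewrite fct_sumE.
  have /rowP/(_ (enum_rank f)) := aC; rewrite !mxE => aCf.
  rewrite -[RHS]aCf; apply: eq_bigr => i _.
  by rewrite mxE enum_rankK.
have := rep_sum (fun i => a 0 i) sc; rewrite c0 => /rep0 u0.
rewrite (ip_aeq mOm _ _ _ u0); [exact: ip0 | | exact: L2_0 | exact/SL2/Ss].
by apply/SL2/subspace_sum.
Qed.

(** The projection is the Fourier sum along a maximal orthonormal family: by
    maximality the remainder r of any q in S has norm 0, since otherwise r
    normalised could be added to the family. *)
Theorem projection_exists (g : Rd -> R) : L2 Om g ->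
  exists p, S p /\ forall q, S q -> ip Om (g \- p) q = 0.
Proof.
move=> Lg.
pose P n := `[< exists s : 'I_n -> Rd -> R, orthonormal s >].
have P0 : exists n, P n.
  by exists 0%N; apply/asboolP; exists (fun=> 0); split=> -[].
have PF n : P n -> (n <= #|F|)%N by move=> /asboolP[s]; exact: orthonormal_size.
case: (ex_maxnP P0 PF) => n /asboolP[s os] nmax; have [Ss sE] := os.
have Ls i : L2 Om (s i) by exact/SL2/Ss.
pose proj u := \sum_i ip Om u (s i) *: s i.
have Sproj u : S (proj u) by exact: subspace_sum.
have perp u i : L2 Om u -> ip Om (u - proj u) (s i) = 0.
  by move=> Lu; rewrite ipB// ?ip_orthonormal// ?subrr//; exact: SL2.
exists (proj g); split=> // q Sq.
have Lq := SL2 Sq; have Lpg := SL2 (Sproj g); have Lpq := SL2 (Sproj q).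
set r := q - proj q.
have Sr : S r by rewrite /r addrC -scaleN1r; apply: subS.2.
have Lr : L2 Om r := SL2 Sr.
have r0 : ip Om r r = 0.
  apply/eqP; apply: contraT => rn0.
  have rgt0 : 0 < ip Om r r by rewrite lt_neqAle eq_sym rn0 ip_ge0.
  pose e := (Num.sqrt (ip Om r r))^-1 *: r.
  have Se : S e by rewrite /e -[_ *: _]addr0; apply: subS.2 => //; case: subS.
  have Le := SL2 Se.
  have es i : ip Om e (s i) = 0 by rewrite ipZ// perp// mulr0.
  have ee : ip Om e e = 1.
    rewrite ipZ// ipC ipZ// mulrA -invfM -expr2 sqr_sqrtr ?ltW// mulVf//.
  (* The normalised remainder e is put in front of the family. *)
  have : P n.+1.
    apply/asboolP; exists (fun i => if unlift ord0 i is Some j then s j else e).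
    split=> [i|i j]; first by case: unliftP.
    case: (unliftP ord0 i) => [i'|] ->; case: (unliftP ord0 j) => [j'|] ->.
    - by rewrite sE (inj_eq lift_inj).
    - by rewrite ipC es eq_sym (negbTE (neq_lift _ _)).
    - by rewrite es (negbTE (neq_lift _ _)).
    - by rewrite ee eqxx.
  by move=> /nmax; rewrite ltnn.
have Lgp : L2 Om (g - proj g) by exact: L2B.
have gr : ip Om (g - proj g) r = 0.
  rewrite ipC (ip_aeq mOm Lr _ Lgp (ip_self0 mOm Lr r0)) ?ip0//; exact: L2_0.
have -> : q = r + proj q by rewrite /r subrK.
rewrite -[g \- proj g]/(g - proj g) ipC (ipD mOm Lr Lpq Lgp) ipC gr add0r.
rewrite (ip_sum mOm) // => [|i]; last exact: L2Z.
apply: big1 => i _.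
by rewrite (ipZ mOm _ (Ls i) Lgp) [X in _ * X]ipC (perp _ _ Lg) mulr0.
Qed.

End projection.

Section Qperp_projection.
Context {R : realType} {d : nat}.
Local Notation Rd := 'rV[R]_d.
Local Notation mu := (leb d).
Variables (Om : set Rd) (Th : mesh R d) (k : nat).
Variable Qloc : simplex R d -> set (mpoly.mpoly d R).
Hypothesis oOm : open Om.
Hypothesis bOm : bounded_set Om.
Hypothesis OmTh : closure Om = \bigcup_(T in [set` Th]) Defs.conv T.

Let mOm : measurable Om. Proof. exact: open_measurable_row. Qed.

Lemma Pk_subspace n : is_subspace (@Pk R d n).
Proof.
split; first by rewrite /Pk/= mpoly.msize0.
move=> a p q pn qn; rewrite /Pk/= (leq_trans (mpoly.msizeD_le _ _))// geq_max.
by rewrite (leq_trans (mpoly.msizeZ_le _ _)).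
Qed.

Lemma peval_comb (a : R) (p q : mpoly.mpoly d R) :
  peval (a *: p + q) = a *: peval p + peval q.
Proof. by apply/funext => x; rewrite /peval mpoly.mevalD mpoly.mevalZ. Qed.

Lemma aeq_comb (A : set Rd) (a : R) (u v u' v' : Rd -> R) :
  aeq A u u' -> aeq A v v' -> aeq A (a *: u + v) (a *: u' + v').
Proof.
by apply: filterS2 => x uu vv Ax; rewrite !fctE uu// vv.
Qed.

Lemma Qperp_L2 : Qperp Om Th k Qloc `<=` L2 Om.
Proof. by move=> q [[[]]]. Qed.

Lemma Qperp_subspace : is_subspace (Qperp Om Th k Qloc).
Proof.
have int0 : \int[mu]_(x in Om) (0 : Rd -> R) x = 0.
  by rewrite /Rintegral integral0.
split.
  split; last by move=> p _; exact: ip0.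
  split; split; try exact: L2_0; last exact: int0.
  move=> T _; exists 0; first by case: (Pk_subspace k.-1).
  by apply: aeW => x _; rewrite /peval mpoly.meval0.
move=> a u v [[[Lu pu] [_ u0]] uq] [[[Lv pv] [_ v0]] vq].
have Luv : L2 Om (a *: u + v) by exact: L2_comb.
split; last first.
  by move=> p Qp; rewrite ip_comb ?uq ?vq ?mulr0 ?addr0//; case: Qp => -[].
split; split=> //.
  move=> T TTh; have [p pk up] := pu T TTh; have [q qk vq'] := pv T TTh.
  exists (a *: p + q); first exact: (Pk_subspace k.-1).2.
  by rewrite peval_comb; exact: aeq_comb.
have [iu iv] := (L2_integrable mOm bOm Lu, L2_integrable mOm bOm Lv).
rewrite RintegralD//; last by have := integrableZl mOm a iu.
by rewrite v0 addr0 [LHS](RintegralZl _ mOm iu) u0 mulr0.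
Qed.

(** A piecewise polynomial is determined almost everywhere by the monomial
    coefficients of its pieces, because the simplices cover the domain; so
    these coefficients serve as coordinates. *)
Theorem Qperp_l2proj (g : Rd -> R) : L2 Om g ->
  Qperp Om Th k Qloc (l2proj Om (Qperp Om Th k Qloc) g) /\
  forall q, Qperp Om Th k Qloc q ->
    ip Om (g \- l2proj Om (Qperp Om Th k Qloc) g) q = 0.
Proof.
move=> Lg; rewrite /l2proj; set Q := Qperp _ _ _ _.
suff /getPex : exists p, Q p /\ forall q, Q q -> ip Om (g \- p) q = 0 by [].
pose F := ('I_(size Th) * mpoly.bmultinom d k.-1.+1)%type.
pose rep (u : Rd -> R) (c : F -> R) := forall j : 'I_(size Th),
  aeq (Defs.conv (tnth (in_tuple Th) j)) u
    (fun x => \sum_m c (j, m) * peval (mpoly.mpolyX R (mpoly.bmnm m)) x).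
apply: (@projection_exists _ _ Om mOm Q Qperp_subspace Qperp_L2 F rep) => //.
- move=> u [[[_ pu] _] _].
  have /choice[p pP] : forall j : 'I_(size Th), exists p,
      Pk k.-1 p /\ aeq (Defs.conv (tnth (in_tuple Th) j)) u (peval p).
    by move=> j; have [p] := pu _ (mem_tnth j (in_tuple Th)); exists p.
  exists (fun jm => mpoly.mcoeff (mpoly.bmnm jm.2) (p jm.1)) => j.
  have [pk] := pP j; apply: filterS => x /[apply] ->.
  rewrite {1}(mpoly.mpolywE pk) /peval raddf_sum; apply: eq_bigr => m _.
  by rewrite /= mpoly.mevalZ.
- move=> a u v c c' uc vc j; move: (uc j) (vc j).
  apply: filterS2 => x ux vx Ax; rewrite !fctE ux// vx// scaler_sumr -big_split.
  by apply: eq_bigr => m _; rewrite /= scalerAl -mulrDl.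
- by move=> j; apply: aeW => x _; rewrite big1// => m _; exact: mul0r.
- move=> u u0.
  have : \forall x \ae mu, forall j : 'I_(size Th),
      Defs.conv (tnth (in_tuple Th) j) x -> u x = 0.
    apply: filter_forall => j; move: (u0 j); apply: filterS => x /[apply] ->.
    by rewrite big1// => m _; exact: mul0r.
  apply: filterS => x ux Omx.
  have : closure Om x by exact: subset_closure.
  rewrite OmTh => -[T /= TTh Tx].
  have /tnthP[j Tj] : T \in in_tuple Th by [].
  by apply: (ux j); rewrite -Tj.
Qed.

End Qperp_projection.

(** * The constrained space as a graph *)

Theorem lemma6p1 (R : realType) (d : nat) (Om : set 'rV[R]_d)
    (I : Type) (Th : I -> mesh R d) (k : nat)
    (Qloc : I -> simplex R d -> set (mpoly.mpoly d R))
    (What : set ('rV[R]_d -> 'rV[R]_d))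
    (VR : I -> set ('rV[R]_d -> 'rV[R]_d))
    (d23 : d = 2%N \/ d = 3%N)
    (Om_domain : bounded_polyhedral_lipschitz_domain Om)
    (Th_conforming : forall i, conforming_triangulation Om (Th i))
    (Th_regular : shape_regular Th)
    (k_ge_d : (d <= k)%N)
    (Qloc_subspace : forall i T, T \in Th i -> is_subspace (Qloc i T))
    (P0_sub_Qloc : forall i T, T \in Th i -> Pk 0 `<=` Qloc i T)
    (Qloc_sub_P : forall i T, T \in Th i -> Qloc i T `<=` Pk k.-1)
    (Qhat_stable : inf_sup_stable Om Th k Qloc)
    (What_subspace : is_subspace What)
    (RTtilde_complement : forall i,
       is_complement Om (RTint Om (Th i) k.-1)
         (RTint Om (Th i) k.-1 `&` div_free Om) (RTtilde Om (Th i) What))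
    (VR_subspace : forall i, is_subspace (VR i))
    (VR_sub_RTtilde : forall i, VR i `<=` RTtilde Om (Th i) What)
    (VR_div_bijective : forall i,
       div_bijective Om (Th i) k (Qloc i) (VR i)) :
  forall i,
    same_classes Om (Vhat Om (Th i) k (Qloc i) (VR i))
      [set (v, - calR Om (Th i) k (Qloc i) (VR i) v) | v in Vct Om (Th i) k].
Proof.
move=> i; have [[_ oOm _ bOm] _] := Om_domain.
have mOm : measurable Om by exact: open_measurable_row.
have [_ OmTh _] := Th_conforming i.
set Q := Qperp Om (Th i) k (Qloc i).
have [VR0 VRcomb] := VR_subspace i.
have [divVR VRinj VRsurj] := VR_div_bijective i.
have QL2 : Q `<=` L2 Om := @Qperp_L2 _ _ _ _ _ _.
have [_ Qcomb] : is_subspace Q := Qperp_subspace _ _ _ oOm bOm.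
have VRHdiv w : VR i w -> Hdiv Om w.
  move=> /VR_sub_RTtilde Vw; have [_ WS _ _] := RTtilde_complement i.
  by have [] := WS _ Vw.
have VctHdiv v : Vct Om (Th i) k v -> Hdiv Om v.
  by move=> [_ Hv]; exact: H10v_Hdiv.
have VRN w : VR i w -> VR i (- w).
  by move=> Vw; rewrite -[- w]addr0 -scaleN1r; exact: VRcomb.
pose p v := l2proj Om Q (div Om v).
have pP v : Vct Om (Th i) k v ->
    Q (p v) /\ forall q, Q q -> ip Om (div Om v \- p v) q = 0.
  by move=> Vv; apply: Qperp_l2proj => //; exact/div_L2/VctHdiv.
have RP v : Vct Om (Th i) k v ->
    VR i (calR Om (Th i) k (Qloc i) (VR i) v) /\
    aeq Om (div Om (calR Om (Th i) k (Qloc i) (VR i) v)) (p v).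
  move=> Vv; have [Qp _] := pP v Vv; have [w Vw wp] := VRsurj _ Qp.
  by apply: (@getPex _ [set w | VR i w /\ aeq Om (div Om w) (p v)]); exists w.
have divD v w q : Vct Om (Th i) k v -> VR i w -> Q q ->
    \int[leb d]_(x in Om) (div Om (v \+ w) x * q x) =
    ip Om (div Om v) q + ip Om (div Om w) q.
  move=> /VctHdiv Hv /VRHdiv Hw /QL2 Lq.
  rewrite -[LHS]/(ip Om (div Om (v + w)) q).
  have Hvw : Hdiv Om (v + w) by rewrite -[v]scale1r; exact: Hdiv_comb.
  have [Lv Lw] := (div_L2 Hv, div_L2 Hw).
  rewrite (ip_aeq mOm _ _ Lq (div_add oOm bOm Hv Hw)) ?ipD//; first exact: div_L2.
  exact: L2D.
have divN w : VR i w -> aeq Om (div Om (- w)) (- div Om w).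
  by move=> /VRHdiv; exact: div_opp.
split.
- move=> [v w] [[/= Vv Vw] vw].
  exists (v, - calR Om (Th i) k (Qloc i) (VR i) v); first by exists v.
  split; first exact: aeW.
  have [VRv Rv] := RP v Vv; have [Qp pq] := pP v Vv.
  have [p2 Qp2 wp2] := divVR w Vw.
  have Qs : Q (p v + p2) by rewrite -[p v]scale1r; exact: Qcomb.
  have s0 : ip Om (p v + p2) (p v + p2) = 0.
    have := vw _ Qs; rewrite divD//.
    rewrite (ip_aeq mOm _ _ (QL2 _ Qs) wp2); [|exact/div_L2/VRHdiv|exact: QL2].
    have := pq _ Qs; rewrite -[_ \- _]/(div Om v - p v).
    rewrite ipB//; [|exact/div_L2/VctHdiv|exact: QL2|exact: QL2].
    move=> /eqP; rewrite subr_eq0 => /eqP ->.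
    by rewrite -ipD//; exact: QL2.
  have := ip_self0 mOm (QL2 _ Qs) s0 => pp2.
  have : aeq Om (- w) (calR Om (Th i) k (Qloc i) (VR i) v).
    apply: VRinj => //; first exact: VRN.
    apply: filterS2 (filterI (divN _ Vw) Rv) (filterI wp2 pp2) => x [a b] [c e] Ox.
    rewrite a// b// !fctE c//; apply/eqP.
    by rewrite eq_sym -addr_eq0; apply/eqP; exact: e.
  by apply: filterS => x /= /[apply] wr; exact: (canRL (@opprK _) wr).
- move=> _ [v Vv <-]; exists (v, - calR Om (Th i) k (Qloc i) (VR i) v); last first.
    by split; exact: aeW.
  have [VRv Rv] := RP v Vv; have [Qp pq] := pP v Vv.
  split; first by split=> //=; exact: VRN.
  move=> q Qq; have Lq := QL2 _ Qq; rewrite divD//; last exact: VRN.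
  have Np : aeq Om (div Om (- calR Om (Th i) k (Qloc i) (VR i) v)) (- p v).
    by apply: filterS2 (divN _ VRv) Rv => x a b Ox; rewrite a// !fctE b.
  have [Lv Lp] := (div_L2 (VctHdiv _ Vv), QL2 _ Qp).
  have LNp : L2 Om (- p v) by rewrite -scaleN1r; exact: L2Z.
  rewrite (ip_aeq mOm _ _ Lq Np)//; last exact/div_L2/VRHdiv/VRN.
  by rewrite -ipD//; exact: pq.
Qed.
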